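(* Let $(S,+)$ be a Clifford semigroup and let $\mathfrak{R}:S\to S$ be a Rota--Baxter operator on $(S,+)$. Then $(S,+)$ endowed with the operation $\circ$ defined by $$a\circ b := a+\mathfrak{R}(a)+b-\mathfrak{R}(a)\qquad (a,b\in S)$$ is a dual weak brace $(S,+,\circ)$.
   Context: An inverse semigroup is a semigroup in which every element $a$ has a unique inverse $a^{-1}$ with $aa^{-1}a=a$ and $a^{-1}aa^{-1}=a^{-1}$. A Clifford semigroup is an inverse semigroup with $aa^{-1}=a^{-1}a$ for all $a$ (equivalently, whose idempotents are central). Clifford semigroups are written additively here (not assumed commutative): $-a$ is the inverse of $a$, $a-b:=a+(-b)$, and $a^0:=a-a=-a+a$. A Rota--Baxter operator on a Clifford semigroup $(S,+)$ is a map $\mathfrak{R}:S\to S$ such that, for all $a,b\in S$, $\mathfrak{R}(a)+\mathfrak{R}(b)=\mathfrak{R}(a+\mathfrak{R}(a)+b-\mathfrak{R}(a))$ and $a+\mathfrak{R}(a)^0=a$. A weak brace is a triple $(S,+,\circ)$ such that $(S,+)$ and $(S,\circ)$ are inverse semigroups and, for all $a,b,c\in S$, $a\circ(b+c)=a\circ b-a+a\circ c$ and $a\circ a^-=-a+a$, where $-a$ and $a^-$ are the inverses of $a$ in $(S,+)$ and $(S,\circ)$ respectively, and $\circ$ has higher precedence than $+$. A weak brace is a dual weak brace if $(S,\circ)$ is a Clifford semigroup. *)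

(* Defs.v *)
From mathcomp Require Import ssreflect ssrfun.

Set Implicit Arguments.
Unset Strict Implicit.
Unset Printing Implicit Defensive.

(* A weak brace carries two semigroup operations on one carrier, and the
   additive one need not be commutative or have a zero, so structures are
   predicates on explicit operations.  The inversion map is also explicit: it
   is determined by the operation, because [inverse_semigroup] requires it to
   return the unique inverse of each element. *)

Definition is_inverse (S : Type) (op : S -> S -> S) (a b : S) : Prop :=
  op (op a b) a = a /\ op (op b a) b = b.

Record inverse_semigroup (S : Type) (op : S -> S -> S) (inv : S -> S) : Prop :=
  InverseSemigroup {
    inverse_semigroupA : associative op;
    inverse_semigroupV : forall a, unique (is_inverse op a) (inv a)
  }.

Record clifford_semigroup (S : Type) (op : S -> S -> S) (inv : S -> S) : Prop :=
  CliffordSemigroup {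
    clifford_inverse_semigroup : inverse_semigroup op inv;
    clifford_comm : forall a, op a (inv a) = op (inv a) a
  }.

Section AdditiveNotation.

Variables (S : Type) (add : S -> S -> S) (opp : S -> S).

Local Notation "a + b" := (add a b).
Local Notation "- a" := (opp a).
Local Notation "a - b" := (a + - b).

Definition idem_of (a : S) : S := a - a.

Record rota_baxter (R : S -> S) : Prop := RotaBaxter {
  rota_baxterE : forall a b, R a + R b = R (a + R a + b - R a);
  rota_baxter_idem : forall a, a + idem_of (R a) = a
}.

Definition rb_circ (R : S -> S) (a b : S) : S := a + R a + b - R a.

Variables (circ : S -> S -> S) (cinv : S -> S).

Local Notation "a 'o' b" := (circ a b) (at level 40, left associativity).

Record weak_brace : Prop := WeakBrace {
  weak_brace_add : inverse_semigroup add opp;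
  weak_brace_circ : inverse_semigroup circ cinv;
  weak_brace_distr : forall a b c, a o (b + c) = a o b - a + a o c;
  weak_brace_idem : forall a, a o cinv a = - a + a
}.

Record dual_weak_brace : Prop := DualWeakBrace {
  dual_weak_brace_weak : weak_brace;
  dual_weak_brace_clifford : clifford_semigroup circ cinv
}.

End AdditiveNotation.

(* Main.v *)
Require Import Defs.
From mathcomp Require Import ssreflect ssrfun.

(** Additive idempotents are central, and [R] sends an idempotent [e] to an
    idempotent with [e + R e = e], so [rb_circ] agrees with addition as soon as
    one argument is idempotent.  Conversely, if [x] is a circle idempotent then
    [R x + R x = R x], so [x + R x = x] and the circle square of [x] is [x + x].
    Hence circle idempotents are additive idempotents and central, and
    [- R a - a + R a] is a circle inverse of [a] because [R] maps it to
    [- R a]. *)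

(** * Inverse semigroups: uniqueness of inverses and commuting idempotents *)

Section InverseSemigroup.

Set Implicit Arguments.
Unset Strict Implicit.

Variables (S : Type) (op : S -> S -> S).

Local Notation "a * b" := (op a b).

(** If [b] and [c] are both inverses of [a], commuting [a * b] with [a * c] gives [b = b * a * c],
    and commuting [b * a] with [c * a] gives [b * a * c = c]. *)
Lemma commuting_idem_inverse_semigroup (inv : S -> S) :
    associative op ->
    (forall e f, e * e = e -> f * f = f -> e * f = f * e) ->
    (forall a, is_inverse op a (inv a)) ->
  inverse_semigroup op inv.
Proof.
move=> A idC invP; split=> // a; split=> // c [aca cac].
have [aba bab] := invP a; set b := inv a in aba bab *.
have abI : (a * b) * (a * b) = a * b by rewrite A aba.
have acI : (a * c) * (a * c) = a * c by rewrite A aca.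
have baI : (b * a) * (b * a) = b * a by rewrite A bab.
have caI : (c * a) * (c * a) = c * a by rewrite A cac.
have -> : b = b * a * c.
  by rewrite -{1}bab -{1}aca -!A (A a c) (idC _ _ acI abI) !A bab.
by rewrite -{2}cac -{2}aba !A -(A (c * a)) (idC _ _ caI baI) -!A (A c) cac.
Qed.

Variable inv : S -> S.
Hypothesis opV : inverse_semigroup op inv.

Local Notation "a ^-1" := (inv a).

Let A : associative op := inverse_semigroupA opV.

Lemma inverseE a b : is_inverse op a b -> a^-1 = b.
Proof. by move=> ab; have [_] := inverse_semigroupV opV a; apply. Qed.

Lemma mulKinv a : a * a^-1 * a = a.
Proof. by have [[]] := inverse_semigroupV opV a. Qed.

Lemma invKmul a : a^-1 * a * a^-1 = a^-1.
Proof. by have [[]] := inverse_semigroupV opV a. Qed.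

Lemma inverseK a : a^-1^-1 = a.
Proof. by apply: inverseE; split; rewrite ?invKmul ?mulKinv. Qed.

Lemma idem_inv e : e * e = e -> e^-1 = e.
Proof. by move=> ee; apply: inverseE; split; rewrite !ee. Qed.

(** With [x] the inverse of [e * f], uniqueness forces [x = f * x * e], which makes [x] idempotent.
    So [x] is its own inverse, that is, [x = e * f]. *)
Lemma idem_mul e f : e * e = e -> f * f = f -> (e * f) * (e * f) = e * f.
Proof.
move=> ee ff; set x := (e * f)^-1.
have xx : x * (e * f) * x = x by exact: invKmul.
have xE : x = f * x * e.
  apply: inverseE; split.
    have -> : e * f * (f * x * e) * (e * f) = e * (f * f) * x * (e * e * f).
      by rewrite !A.
    by rewrite ee ff mulKinv.
  have -> : f * x * e * (e * f) * (f * x * e) =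
      f * (x * (e * e * (f * f)) * x) * e by rewrite !A.
  by rewrite ee ff xx.
have xI : x * x = x.
  have : (f * x * e) * (f * x * e) = f * (x * (e * f) * x) * e by rewrite !A.
  by rewrite xx -xE.
by have := idem_inv xI; rewrite inverseK => ->.
Qed.

(** The idempotent [e * f] is its own inverse, and [f * e] is another inverse of it. *)
Lemma idem_comm e f : e * e = e -> f * f = f -> e * f = f * e.
Proof.
move=> ee ff; have efI := idem_mul ee ff; have feI := idem_mul ff ee.
rewrite -(idem_inv efI); apply: inverseE; split.
  by rewrite !A -(A e f f) ff -(A _ e e) ee -A.
by rewrite !A -(A f e e) ee -(A _ f f) ff -A.
Qed.

Lemma mulV_idem a : (a * a^-1) * (a * a^-1) = a * a^-1.
Proof. by rewrite A mulKinv. Qed.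

Lemma Vmul_idem a : (a^-1 * a) * (a^-1 * a) = a^-1 * a.
Proof. by rewrite A invKmul. Qed.

Lemma invM a b : (a * b)^-1 = b^-1 * a^-1.
Proof.
have C := idem_comm (mulV_idem b) (Vmul_idem a).
apply: inverseE; split.
  have -> : a * b * (b^-1 * a^-1) * (a * b) = a * (b * b^-1 * (a^-1 * a)) * b.
    by rewrite !A.
  by rewrite C !A mulKinv -!A (A b) mulKinv.
have -> : b^-1 * a^-1 * (a * b) * (b^-1 * a^-1) =
    b^-1 * (a^-1 * a * (b * b^-1)) * a^-1 by rewrite !A.
by rewrite -C !A invKmul -!A (A a^-1) invKmul.
Qed.

End InverseSemigroup.

(** * Clifford semigroups: centrality of idempotents *)

Section Clifford.

Set Implicit Arguments.
Unset Strict Implicit.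

Variables (S : Type) (add : S -> S -> S) (opp : S -> S).
Hypothesis hS : clifford_semigroup add opp.

Local Notation "a + b" := (add a b).
Local Notation "- a" := (opp a).
Local Notation "a - b" := (a + - b).

Let hI : inverse_semigroup add opp := clifford_inverse_semigroup hS.
Let A : associative add := inverse_semigroupA hI.

Lemma idem_central e a : e + e = e -> e + a = a + e.
Proof.
move=> ee; have oe := idem_inv hI ee.
have C := idem_comm hI ee (mulV_idem hI a).
(* This is the Clifford identity for [e + a]: conjugating [e] by [a] only cuts it down by [a - a],
   which [a] absorbs. *)
have H : e + (a - a) = - a + e + a.
  have := clifford_comm hS (e + a); rewrite (invM hI) oe.
  have -> : e + a + (- a + e) = e + (a - a) + e by rewrite !A.
  have -> : - a + e + (e + a) = - a + (e + e) + a by rewrite !A.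
  by rewrite C -A ee.
have {1}-> : e + a = a + (- a + e + a).
  by rewrite -{1}(mulKinv hI a) A C -!A.
by rewrite -H C (clifford_comm hS) !A (mulKinv hI).
Qed.

End Clifford.

(** * The circle operation of a Rota--Baxter operator *)

Section RotaBaxter.

Set Implicit Arguments.
Unset Strict Implicit.

Variables (S : Type) (add : S -> S -> S) (opp : S -> S).
Hypothesis hS : clifford_semigroup add opp.
Variable R : S -> S.
Hypothesis hR : rota_baxter add opp R.

Local Notation "a + b" := (add a b).
Local Notation "- a" := (opp a).
Local Notation "a - b" := (a + - b).
Local Notation circ := (rb_circ add opp R).
Local Notation "a 'o' b" := (circ a b) (at level 40, left associativity).

Let hI : inverse_semigroup add opp := clifford_inverse_semigroup hS.
Let A : associative add := inverse_semigroupA hI.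
Let subK a : a - a + a = a. Proof. exact: mulKinv hI a. Qed.
Let subI a : (a - a) + (a - a) = a - a. Proof. exact: mulV_idem hI a. Qed.
Let Vsub a : - a + a = a - a. Proof. by rewrite (clifford_comm hS). Qed.
Let central e a (ee : e + e = e) : e + a = a + e := idem_central hS a ee.
Let rbM a b : R (a o b) = R a + R b. Proof. by rewrite (rota_baxterE hR). Qed.
Let rbK a : a + (R a - R a) = a. Proof. exact: rota_baxter_idem hR a. Qed.

(** The product [a o b] conjugates [b] by [R a]; the opposite conjugation is applied to [- a] to
    undo this. *)
Definition rb_inv (a : S) : S := - R a - a + R a.

(** Since [R] turns circle into addition, the two sides differ by the idempotent [- R a + R a],
    which is central and absorbed by [R a]. *)
Lemma rb_circA : associative circ.
Proof.
move=> a b c.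
have -> : (a o b) o c = a o b + (R a + R b) + c - (R a + R b) by rewrite -rbM.
rewrite /rb_circ (invM hI).
have -> : a + R a + b - R a + (R a + R b) + c + (- R b - R a) =
  a + R a + (b + (- R a + R a)) + (R b + c - R b - R a) by rewrite !A.
rewrite Vsub -(central b (subI (R a))).
have -> : a + R a + (R a - R a + b) = a + (R a + (R a - R a)) + b by rewrite !A.
by rewrite -(central (R a) (subI (R a))) subK !A.
Qed.

Lemma rb_idem_add e : e + e = e -> R e + R e = R e /\ e + R e = e.
Proof.
move=> ee.
have eoe : e o e = e.
  by rewrite /rb_circ -(central (e + R e) ee) A ee -A rbK.
have ReI : R e + R e = R e by rewrite -rbM eoe.
by split=> //; have := rbK e; rewrite (idem_inv hI ReI) ReI.
Qed.

Lemma rb_idem_circ e b : e + e = e -> e o b = e + b.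
Proof.
move=> ee; have [ReI eRe] := rb_idem_add ee.
rewrite /rb_circ eRe (idem_inv hI ReI) -A.
by rewrite -(central b ReI) A eRe.
Qed.

Lemma rb_circ_idem e b : e + e = e -> b o e = e + b.
Proof. by move=> ee; rewrite /rb_circ -(central (b + R b) ee) -!A rbK. Qed.

Lemma rb_idemE e : e o e = e -> e + e = e.
Proof.
move=> eoe; have ReI : R e + R e = R e by rewrite -rbM eoe.
have oRe := idem_inv hI ReI.
have eRe : e + R e = e by have := rbK e; rewrite oRe ReI.
by move: eoe; rewrite /rb_circ oRe eRe -A eRe.
Qed.

(** In the natural order of idempotents, [a - a] lies below [R a - R a]; this absorbs the leftovers
    of conjugation by [R a]. *)
Lemma rb_sub_add a : a - a + (R a - R a) = a - a.
Proof. by rewrite -(central _ (subI (R a))) A (central a (subI (R a))) rbK. Qed.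

Lemma rb_oppK a : - a + (R a - R a) = - a.
Proof. by rewrite -(invKmul hI a) -(A (- a)) -A rb_sub_add. Qed.

Lemma rb_circV a : a o rb_inv a = a - a.
Proof.
rewrite /rb_circ /rb_inv.
have -> : a + R a + (- R a - a + R a) - R a = a + (R a - R a) - a + (R a - R a).
  by rewrite !A.
by rewrite rbK -A rb_oppK.
Qed.

(** The left side is [rb_inv a - rb_inv a] expanded, and also [rb_inv a o a] once
    [R (rb_inv a) = - R a] is known. *)
Lemma rb_conj_sub a : - R a - a + R a - R a + a + R a = a - a.
Proof.
have -> : - R a - a + R a - R a + a + R a =
    - R a + (- a + (R a - R a) + a) + R a.
  by rewrite !A.
by rewrite rb_oppK Vsub -(central (- R a) (subI a)) -A Vsub rb_sub_add.
Qed.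

Lemma rb_inv_sub a : rb_inv a - rb_inv a = a - a.
Proof. by rewrite /rb_inv !(invM hI) !(inverseK hI) A A rb_conj_sub. Qed.

Lemma rb_invE a : R (rb_inv a) = - R a.
Proof.
set b := rb_inv a.
have RaRb : R a + R b = R (a - a) by rewrite -rbM rb_circV.
have Ra : R (a - a) + R a = R a by rewrite -rbM rb_idem_circ // subK.
have Rb : R (a - a) + R b = R b.
  by rewrite -rbM -(rb_inv_sub a) rb_idem_circ ?subI // subK.
(* Each idempotent absorbs the other: [R (a - a)] fixes [R a], while [R a - R a] fixes
   [R a + R b = R (a - a)]. *)
have Z : R (a - a) = R a - R a.
  have ZRa : R (a - a) + (R a - R a) = R a - R a by rewrite A Ra.
  by rewrite -[RHS]ZRa -(central _ (subI (R a))) -RaRb A subK.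
by rewrite -Rb Z -Vsub -A RaRb Z A (invKmul hI).
Qed.

Lemma rb_Vcirc a : rb_inv a o a = a - a.
Proof. by rewrite /rb_circ rb_invE (inverseK hI) /rb_inv rb_conj_sub. Qed.

Lemma rb_circ_is_inverse a : is_inverse circ a (rb_inv a).
Proof.
split; first by rewrite rb_circV rb_idem_circ // subK.
by rewrite rb_Vcirc rb_idem_circ // -rb_inv_sub subK.
Qed.

(** On the right, [- a + a] meets conjugation by [R a]; being central, it swallows [- R a + R a],
    moves to the front and vanishes into [a]. *)
Lemma rb_distr a b c : a o (b + c) = a o b - a + a o c.
Proof.
rewrite /rb_circ.
have -> : a + R a + b - R a - a + (a + R a + c - R a) =
   a + R a + b + (- R a + (- a + a) + R a) + c - R a by rewrite !A.
rewrite Vsub -(central (- R a) (subI a)) -(A _ (- R a)) Vsub rb_sub_add.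
by rewrite -(central (a + R a + b) (subI a)) !A subK.
Qed.

End RotaBaxter.

Theorem theorem16 (S : Type) (add : S -> S -> S) (opp : S -> S)
    (hS : clifford_semigroup add opp)
    (R : S -> S) (hR : rota_baxter add opp R) :
  exists cinv : S -> S, dual_weak_brace add opp (rb_circ add opp R) cinv.
Proof.
have hI := clifford_inverse_semigroup hS.
exists (rb_inv add opp R).
have hC : inverse_semigroup (rb_circ add opp R) (rb_inv add opp R).
  apply: commuting_idem_inverse_semigroup.
  - exact: rb_circA.
  (* Once [e] is an additive idempotent, both circle products equal [e + f]. *)
  - move=> e f /(rb_idemE hS hR) ee _.
    by rewrite (rb_idem_circ hS hR) // (rb_circ_idem hS hR).
  - exact: rb_circ_is_inverse.
split; split=> //.
- exact: rb_distr.
- by move=> a; rewrite (rb_circV hS hR) (clifford_comm hS).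
- by move=> a; rewrite (rb_circV hS hR) (rb_Vcirc hS hR).
Qed.
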